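(* Let $G$ be a connected graph of size $m$ with maximum degree $\Delta$ and minimum degree $\delta$. Then $$\frac{2m^2}{SO(G)}\leq BSO(G)\leq \frac{1}{\delta^2}SO(G),$$ with equality (in either inequality) if and only if $G$ is a regular graph.
   Context: Graphs are finite, simple and undirected; the size of a graph is its number of edges. For a connected graph $G$ with edge set $E(G)$, $d_v$ denotes the degree of the vertex $v$ in $G$. The first Banhatti-Sombor index is $BSO(G)=\sum_{uv\in E(G)}\sqrt{\frac{1}{d_u^2}+\frac{1}{d_v^2}}$ and the Sombor index is $SO(G)=\sum_{uv\in E(G)}\sqrt{d_u^2+d_v^2}$. *)

(* Defs.v *)
From HB Require Import structures.
From mathcomp Require Import all_boot all_order all_algebra.

Set Implicit Arguments.
Unset Strict Implicit.
Unset Printing Implicit Defensive.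

Import Order.TTheory GRing.Theory Num.Theory.
Local Open Scope ring_scope.

Record sgraph := SGraph {
  vertex :> finType;
  adj : rel vertex;
  adj_sym : symmetric adj;
  adj_irrefl : irreflexive adj }.

Definition deg (G : sgraph) (v : G) : nat := #|[set w | adj v w]|.

(* Each undirected edge uv is the two-element set {u, v}, so it is counted once. *)
Definition edges (G : sgraph) : {set {set G}} :=
  [set [set p.1; p.2] | p in [set p : G * G | adj p.1 p.2]].

Definition gsize (G : sgraph) : nat := #|edges G|.

Definition maxdeg (G : sgraph) : nat := (\max_(v : G) deg v)%N.

(* Every degree is smaller than #|G|, so the default value #|G| is never
   attained on a nonempty graph. *)
Definition mindeg (G : sgraph) : nat := \big[minn/#|G|]_(v : G) deg v.

(* The graph with no vertices is not considered connected. *)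
Definition connected (G : sgraph) : Prop :=
  (0 < #|G|)%N /\ forall x y : G, connect (@adj G) x y.

Definition regular (G : sgraph) : Prop := exists d, forall v : G, deg v = d.

(* The real numbers are generalized to an arbitrary real closed field.
   For an edge E = {u, v}, the inner sum over w in E is the two-term sum over
   its endpoints u and v; see sum_edge. *)
Definition BSO (R : rcfType) (G : sgraph) : R :=
  \sum_(E in edges G) Num.sqrt (\sum_(w in E) 1 / (deg w)%:R ^+ 2).

Definition SO (R : rcfType) (G : sgraph) : R :=
  \sum_(E in edges G) Num.sqrt (\sum_(w in E) (deg w)%:R ^+ 2).

Lemma sum_edge (R : rcfType) (G : sgraph) (F : G -> R) (u v : G) :
  adj u v -> \sum_(w in [set u; v]) F w = F u + F v.
Proof.
move=> uv; rewrite big_setU1 ?big_set1 // inE.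
by apply/eqP => uv_eq; rewrite uv_eq adj_irrefl in uv.
Qed.

(* Main.v *)
Require Import Defs.
From HB Require Import structures.
From mathcomp Require Import all_boot all_order all_algebra.
From mathcomp Require Import ring.

Set Implicit Arguments.
Unset Strict Implicit.
Unset Printing Implicit Defensive.

Import Order.TTheory GRing.Theory Num.Theory.
Local Open Scope ring_scope.

(** Both inequalities are sums of inequalities between the contributions of a
    single edge.  For an edge [uv] with [x = deg u], [y = deg v], put
    [b = sqrt (x^2 + y^2)], its contribution to [SO].  Its contribution to
    [BSO] is [b / (x y)] ([sqrt_sum_inv_sqr]).

    For the upper bound, [x y >= delta^2] gives [b / (x y) <= b / delta^2],
    with equality only if [x = y = delta].

    For the lower bound, [2 x y <= b^2] gives [b / (x y) >= 2 / b], with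
    equality only if [x = y].  The sum of the [2 / b] is at least [2 m^2 / SO]
    by the inequality between harmonic and arithmetic means.  That inequality
    is itself made edgewise: by convexity, [2 / b] lies above its tangent line
    at the mean [t = SO / m], namely [2 (2 t - b) / t^2], and these tangent
    values add up to exactly [2 m^2 / SO] ([sum_tangent]).

    So either equality holds if and only if it holds on each edge, which forces
    the endpoints of each edge to have equal degrees; as the graph is connected,
    it is then regular ([sum_edges_le_regular]).  Conversely, in a regular graph
    every edge has [x = y = delta] and [b = t], so both edge inequalities are
    equalities.  In the graph with one vertex all the quantities compared are 0,
    as division by zero gives 0. *)

(** * Connected graphs *)

Lemma edgesP (G : sgraph) (E : {set G}) :
  reflect (exists u v : G, adj u v /\ E = [set u; v]) (E \in edges G).
Proof.
apply: (iffP imsetP) => [[[u v]]|[u [v [uv ->]]]].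
  by rewrite inE /= => uv ->; exists u, v.
by exists (u, v); rewrite ?inE.
Qed.

Lemma deg_gt0 (G : sgraph) (u v : G) : adj u v -> (0 < deg u)%N.
Proof. by move=> uv; rewrite card_gt0; apply/set0Pn; exists v; rewrite inE. Qed.

Lemma adj_deg_gt0 (G : sgraph) (u v : G) :
  adj u v -> (0 < deg u)%N /\ (0 < deg v)%N.
Proof.
move=> uv; split; first exact: deg_gt0 uv.
by apply: (@deg_gt0 _ v u); rewrite adj_sym.
Qed.

Lemma connected_constant (G : sgraph) (T : eqType) (f : G -> T) :
  connected G -> (forall u v : G, adj u v -> f u = f v) ->
  forall x y, f x = f y.
Proof.
move=> [_ conn] adj_f x y.
have clos : closed (@adj G) [pred v | f v == f x].
  by move=> u v /adj_f fuv; rewrite !inE fuv.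
by have := closed_connect clos (conn x y); rewrite !inE eqxx => /esym/eqP.
Qed.

Lemma connected_regular (G : sgraph) :
  connected G -> (forall u v : G, adj u v -> deg u = deg v) -> regular G.
Proof.
move=> conn adj_deg; have [/card_gt0P[x _] _] := conn.
by exists (deg x) => v; apply: connected_constant.
Qed.

(** * Minimum degree *)

Lemma mindeg_le (G : sgraph) (v : G) : (mindeg G <= deg v)%N.
Proof.
rewrite /mindeg; elim: (index_enum G) (mem_index_enum v) => // w s IHs.
rewrite inE big_cons => /orP[/eqP->|/IHs]; first exact: geq_minl.
exact/leq_trans/geq_minr.
Qed.

Lemma leq_mindeg (G : sgraph) (k : nat) :
  (0 < #|G|)%N -> (forall v : G, k <= deg v)%N -> (k <= mindeg G)%N.
Proof.
move=> /card_gt0P[x _] k_deg.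
apply: (big_ind (leq k)) => // [|i j ki kj].
  exact: leq_trans (k_deg x) (max_card _).
by rewrite leq_min ki.
Qed.

Lemma mindeg_regular (G : sgraph) (d : nat) :
  (0 < #|G|)%N -> (forall v : G, deg v = d) -> mindeg G = d.
Proof.
move=> G_gt0 deg_d; apply/eqP; rewrite eqn_leq.
have /card_gt0P[x _] := G_gt0.
rewrite -{1}(deg_d x) mindeg_le leq_mindeg // => v.
by rewrite deg_d.
Qed.

(** Being isolated is a property shared by adjacent vertices, vacuously; so in
    a connected graph one edge excludes isolated vertices altogether. *)
Lemma mindeg_gt0 (G : sgraph) (u v : G) :
  connected G -> adj u v -> (0 < mindeg G)%N.
Proof.
move=> conn uv; have [G_gt0 _] := conn; apply: leq_mindeg => // w.
rewrite (@connected_constant _ _ (fun z : G => 0 < deg z)%N conn _ w u).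
  exact: deg_gt0 uv.
by move=> y z /adj_deg_gt0[-> ->].
Qed.

(** * Summing over edges *)

(** Equality of the two sums is equality on every edge; the last two hypotheses
    relate the latter to regularity, through connectedness. *)
Lemma sum_edges_le_regular (R : rcfType) (G : sgraph) (F H : {set G} -> R) :
  connected G ->
  (forall u v : G, adj u v -> F [set u; v] <= H [set u; v]) ->
  (forall u v : G, adj u v -> F [set u; v] = H [set u; v] -> deg u = deg v) ->
  (regular G -> forall u v : G, adj u v -> F [set u; v] = H [set u; v]) ->
  \sum_(E in edges G) F E <= \sum_(E in edges G) H E /\
  (\sum_(E in edges G) F E = \sum_(E in edges G) H E <-> regular G).
Proof.
move=> conn FH eq_deg reg_eq.
have leFH E : E \in edges G -> F E <= H E ?= iff (F E == H E).
  by move=> /edgesP[u [v [uv ->]]]; split=> //; apply: FH.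
have [le_sum eq_sum] := leif_sum leFH.
split=> //; split=> [/eqP|reg].
  rewrite eq_sum => /forall_inP eqFH; apply: connected_regular => // u v uv.
  by apply: eq_deg => //; apply/eqP/eqFH/edgesP; exists u, v.
apply: eq_bigr => E /edgesP[u [v [uv ->]]]; exact: reg_eq.
Qed.

(** * Inequalities on a single edge *)

Section EdgeInequalities.

Variables (R : rcfType) (x y : R).
Hypotheses (x_gt0 : 0 < x) (y_gt0 : 0 < y).
Let b := Num.sqrt (x ^+ 2 + y ^+ 2).

Lemma sqrt_sum_sqr_gt0 : 0 < b.
Proof. by rewrite sqrtr_gt0 addr_gt0 // exprn_gt0. Qed.

Lemma sqr_sqrt_sum_sqr : b ^+ 2 = x ^+ 2 + y ^+ 2.
Proof. by rewrite sqr_sqrtr // addr_ge0 // sqr_ge0. Qed.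

Lemma sqrt_sum_inv_sqr :
  Num.sqrt (1 / x ^+ 2 + 1 / y ^+ 2) = b / (x * y).
Proof.
have -> : 1 / x ^+ 2 + 1 / y ^+ 2 = (b / (x * y)) ^+ 2.
  by rewrite expr_div_n sqr_sqrt_sum_sqr; field; rewrite !gt_eqF.
by rewrite sqrtr_sqr ger0_norm // divr_ge0 ?ltW ?mulr_gt0 ?sqrt_sum_sqr_gt0.
Qed.

(** The left side passes through [2 / b]: the first summand is
    [b / (x y) - 2 / b], the second is the gap between [2 / b] and its tangent
    line at [t]. *)
Lemma tangent_gap (t : R) : 0 < t ->
  b / (x * y) - 2 * (2 * t - b) / t ^+ 2 =
  (x - y) ^+ 2 / (x * y * b) + 2 * (b - t) ^+ 2 / (b * t ^+ 2).
Proof.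
move=> t_gt0; have b_gt0 := sqrt_sum_sqr_gt0.
have -> : (x - y) ^+ 2 = b ^+ 2 - 2 * x * y by rewrite sqr_sqrt_sum_sqr; ring.
by field; rewrite !gt_eqF.
Qed.

Lemma gap_ge0 (t : R) : 0 < t ->
  0 <= (x - y) ^+ 2 / (x * y * b) /\ 0 <= 2 * (b - t) ^+ 2 / (b * t ^+ 2).
Proof.
move=> t_gt0; have b_gt0 := sqrt_sum_sqr_gt0.
split; apply: divr_ge0.
- exact: sqr_ge0.
- by rewrite ltW // !mulr_gt0.
- by rewrite mulr_ge0 // sqr_ge0.
- by rewrite ltW // mulr_gt0 // exprn_gt0.
Qed.

Lemma tangent_le (t : R) : 0 < t ->
  2 * (2 * t - b) / t ^+ 2 <= b / (x * y).
Proof.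
move=> t_gt0; rewrite -subr_ge0 tangent_gap //.
by have [? ?] := gap_ge0 t_gt0; rewrite addr_ge0.
Qed.

Lemma tangent_eq (t : R) : 0 < t ->
  2 * (2 * t - b) / t ^+ 2 = b / (x * y) -> x = y.
Proof.
move=> t_gt0 /esym/eqP; rewrite -subr_eq0 tangent_gap //.
have [? ?] := gap_ge0 t_gt0; rewrite paddr_eq0 // => /andP[+ _].
have xyb_neq0 : x * y * b != 0.
  by rewrite !mulf_neq0 ?lt0r_neq0 ?sqrt_sum_sqr_gt0.
by rewrite mulf_eq0 invr_eq0 (negbTE xyb_neq0) orbF sqrf_eq0 subr_eq0 => /eqP.
Qed.

Variable c : R.
Hypotheses (c_gt0 : 0 < c) (le_cx : c <= x) (le_cy : c <= y).

Lemma quotient_le : b / (x * y) <= 1 / c ^+ 2 * b.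
Proof.
rewrite mulrC ler_pM2r ?sqrt_sum_sqr_gt0 // div1r lef_pV2 ?posrE
  ?mulr_gt0 ?exprn_gt0 //.
by rewrite expr2 ler_pM // ltW.
Qed.

(** Two numbers that are at least [c] and have product [c^2] both equal [c]. *)
Lemma quotient_eq : b / (x * y) = 1 / c ^+ 2 * b -> x = y.
Proof.
rewrite mulrC => /(mulIf (lt0r_neq0 sqrt_sum_sqr_gt0)).
rewrite div1r => /invr_inj xy_c2.
have eq_c z w : c <= z -> c <= w -> z * w = c ^+ 2 -> z = c.
  move=> le_cz le_cw zw_c2; apply/le_anti; rewrite le_cz andbT.
  rewrite -(ler_pM2r c_gt0) -expr2 -zw_c2 ler_wpM2l //.
  exact: le_trans (ltW c_gt0) le_cz.
by rewrite (eq_c x y) // (eq_c y x) // mulrC.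
Qed.

End EdgeInequalities.

(** * The Sombor index *)

Lemma SO_gt0 (R : rcfType) (G : sgraph) (u v : G) : adj u v -> 0 < SO R G.
Proof.
move=> uv; have uvE : [set u; v] \in edges G by apply/edgesP; exists u, v.
have [u_gt0 v_gt0] := adj_deg_gt0 uv.
rewrite /SO (bigD1 [set u; v]) //= (sum_edge _ uv).
rewrite ltr_wpDr ?sqrt_sum_sqr_gt0 ?ltr0n // sumr_ge0 // => E _.
exact: sqrtr_ge0.
Qed.

Lemma gsize_gt0 (G : sgraph) (u v : G) : adj u v -> (0 < gsize G)%N.
Proof.
move=> uv; rewrite card_gt0; apply/set0Pn; exists [set u; v].
by apply/edgesP; exists u, v.
Qed.

(** If there are edges, their contributions to [SO] average to [t], so the
    tangent values at [t] average to [2 / t]. *)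
Lemma sum_tangent (R : rcfType) (G : sgraph) (t := SO R G / (gsize G)%:R) :
  \sum_(E in edges G)
     2 * (2 * t - Num.sqrt (\sum_(w in E) (deg w)%:R ^+ 2)) / t ^+ 2 =
  2 * (gsize G)%:R ^+ 2 / SO R G.
Proof.
rewrite -mulr_suml -mulr_sumr sumrB sumr_const -/(gsize G) -/(SO R G).
have [edges0|[E /edgesP[u [v [uv _]]]]] := set_0Vmem (edges G).
  (* without edges t is 0 / 0 and both sides are 0 *)
  rewrite /t /gsize /SO edges0 cards0 big_set0.
  by rewrite !(mul0r, mulr0n, subr0, mulr0, invr0).
have S_gt0 := SO_gt0 R uv; have m_gt0 := gsize_gt0 uv.
rewrite -[_ *+ gsize G]mulr_natr /t.
by field; rewrite gt_eqF // pnatr_eq0 -lt0n.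
Qed.

Lemma SO_regular (R : rcfType) (G : sgraph) (d : nat) :
  (forall v : G, deg v = d) ->
  SO R G = (gsize G)%:R * Num.sqrt (d%:R ^+ 2 + d%:R ^+ 2).
Proof.
move=> deg_d; rewrite /SO mulr_natl -sumr_const.
by apply: eq_bigr => E /edgesP[u [v [uv ->]]]; rewrite (sum_edge _ uv) !deg_d.
Qed.

Theorem theorem3p20 (R : rcfType) (G : sgraph) (m Delta delta : nat)
    (hconn : connected G) (hm : gsize G = m)
    (hDelta : maxdeg G = Delta) (hdelta : mindeg G = delta) :
  [/\ 2 * m%:R ^+ 2 / SO R G <= BSO R G,
      BSO R G <= 1 / delta%:R ^+ 2 * SO R G,
      (2 * m%:R ^+ 2 / SO R G = BSO R G <-> regular G) &
      (BSO R G = 1 / delta%:R ^+ 2 * SO R G <-> regular G)].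
Proof.
have natr_deg_gt0 (u v : G) :
    adj u v -> 0 < (deg u)%:R :> R /\ 0 < (deg v)%:R :> R.
  by rewrite !ltr0n; apply: adj_deg_gt0.
have [lower lower_eq] :
    2 * m%:R ^+ 2 / SO R G <= BSO R G /\
    (2 * m%:R ^+ 2 / SO R G = BSO R G <-> regular G).
  rewrite -hm -sum_tangent; set t := SO R G / _.
  have t_gt0 (u v : G) : adj u v -> 0 < t.
    by move=> uv; rewrite divr_gt0 ?(SO_gt0 R uv) // ltr0n (gsize_gt0 uv).
  apply: sum_edges_le_regular => // [u v uv|u v uv|[d deg_d] u v uv];
    have [u_gt0 v_gt0] := natr_deg_gt0 _ _ uv;
    rewrite !(sum_edge _ uv) sqrt_sum_inv_sqr //.
  - exact: tangent_le (t_gt0 _ _ uv).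
  - move=> /(tangent_eq u_gt0 v_gt0 (t_gt0 _ _ uv)) /eqP.
    by rewrite eqr_nat => /eqP.
  (* all edges contribute equally to SO, so the mean t is the common
     contribution b, and both summands of the gap vanish *)
  move: u_gt0; rewrite !deg_d => d_gt0.
  have m_neq0 : (gsize G)%:R != 0 :> R.
    by rewrite pnatr_eq0 -lt0n (gsize_gt0 uv).
  have b_gt0 := sqrt_sum_sqr_gt0 d_gt0 d_gt0.
  have -> : t = Num.sqrt (d%:R ^+ 2 + d%:R ^+ 2).
    by rewrite /t (SO_regular R deg_d) mulrAC mulfV // mul1r.
  apply/esym/eqP; rewrite -subr_eq0 tangent_gap // !subrr expr0n /=.
  by rewrite mulr0 !mul0r addr0.
have [upper upper_eq] :
    BSO R G <= 1 / delta%:R ^+ 2 * SO R G /\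
    (BSO R G = 1 / delta%:R ^+ 2 * SO R G <-> regular G).
  rewrite /SO mulr_sumr -hdelta.
  have delta_gt0 (u v : G) : adj u v -> 0 < (mindeg G)%:R :> R.
    by move=> uv; rewrite ltr0n (mindeg_gt0 hconn uv).
  have delta_le (v : G) : (mindeg G)%:R <= (deg v)%:R :> R.
    by rewrite ler_nat mindeg_le.
  apply: sum_edges_le_regular => // [u v uv|u v uv|[d deg_d] u v uv];
    have [u_gt0 v_gt0] := natr_deg_gt0 _ _ uv;
    rewrite !(sum_edge _ uv) sqrt_sum_inv_sqr //.
  - exact: quotient_le (delta_gt0 _ _ uv) _ _.
  - move=> /(quotient_eq u_gt0 v_gt0 (delta_gt0 _ _ uv)) eq_uv.
    by apply/eqP; rewrite -(eqr_nat R) eq_uv.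
  by rewrite (mindeg_regular hconn.1 deg_d) !deg_d -expr2 div1r mulrC.
by split.
Qed.
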